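(* Let $0<c<1$ and let $$\Omega=\{(x,t)\in\mathbb{R}^n\times(-\infty,0):\ -c<t<0,\ |x|^2<-4t\log|\log|t||\,\}$$ be the domain enclosed by the hypersurfaces $\{(x,t)\in\mathbb{R}^n\times(-\infty,0): |x|^2=-4t\log|\log|t||\}$ and $\{t=-c\}$. Then the origin $(x,t)=(0,0)$ is a regular boundary point of $\Omega$ for the normalised $\infty$-heat equation $u_t-\Delta_\infty^N u=0$.
   Context: Let $\Omega\subset\mathbb{R}^n\times\mathbb{R}$ be a bounded domain. Points are written $\zeta=(x,t)$; $D$ and $D^2$ are the gradient and Hessian in the spatial variable $x$ only; $\partial\Omega$ is the Euclidean boundary in $\mathbb{R}^{n+1}$. For $D\psi\ne0$, $\Delta_\infty^N\psi=\frac{1}{|D\psi|^2}\sum_{i,j=1}^n\psi_{x_i}\psi_{x_j}\psi_{x_ix_j}$. For a symmetric matrix $X$, $\Lambda(X)$ is its largest eigenvalue. An upper semicontinuous $u:\Omega\to\mathbb{R}\cup\{-\infty\}$ is a (viscosity) subsolution in $\Omega$ if for every $\psi\in C^2(\Omega)$ such that $u-\psi$ has a maximum at $\zeta_0\in\Omega$ one has $\psi_t(\zeta_0)-\Delta_\infty^N\psi(\zeta_0)\le0$ if $D\psi(\zeta_0)\neq0$, and $\psi_t(\zeta_0)-\Lambda(D^2\psi(\zeta_0))\le0$ if $D\psi(\zeta_0)=0$. Lower Perron solution: for $f:\partial\Omega\to\mathbb{R}$ continuous, the lower class $\mathcal{L}_f$ consists of all subsolutions $v$ in $\Omega$ with $\limsup_{\eta\to\zeta,\,\eta\in\Omega}v(\eta)\le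 f(\zeta)$ for all $\zeta\in\partial\Omega$, and $\underline{H}_f(\zeta)=\sup\{v(\zeta):v\in\mathcal{L}_f\}$ for $\zeta\in\Omega$. Regular point: $\zeta_0\in\partial\Omega$ is a regular boundary point of $\Omega$ if $\lim_{\zeta\to\zeta_0,\,\zeta\in\Omega}\underline{H}_f(\zeta)=f(\zeta_0)$ for every continuous $f:\partial\Omega\to\mathbb{R}$. *)

(* Defs.v *)
From mathcomp Require Import all_boot all_order all_algebra.
From mathcomp Require Import all_classical all_reals all_analysis.
Set Implicit Arguments.
Unset Strict Implicit.
Unset Printing Implicit Defensive.
Import Order.TTheory GRing.Theory Num.Theory.
Import numFieldNormedType.Exports.
Local Open Scope classical_set_scope.
Local Open Scope ring_scope.

(* Points of R^n x R are pairs (x, t).  The norm of 'rV[R]_n is the sup norm;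
   it is only used through the topology it induces, which is the Euclidean one.
   Euclidean lengths are given by [sqnorm]. *)
Definition spacetime (R : realType) (n : nat) : normedModType R :=
  ('rV[R]_n * R)%type.

Definition sqnorm (R : realType) (n : nat) (x : 'rV[R]_n) : R :=
  \sum_(i < n) x ord0 i ^+ 2.

Section calculus.
Context {R : realType} {n : nat}.
Implicit Types (psi : spacetime R n -> R) (z : spacetime R n).

Definition dir_x (i : 'I_n) : spacetime R n := (delta_mx ord0 i, 0).
Definition dir_t : spacetime R n := (0, 1).

Definition dt psi z : R := 'D_dir_t psi z.

Definition grad psi z : 'rV[R]_n := \row_i 'D_(dir_x i) psi z.

Definition hess psi z : 'M[R]_n :=
  \matrix_(i, j) 'D_(dir_x j) ('D_(dir_x i) psi) z.

Definition norm_inf_laplacian psi z : R :=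
  (sqnorm (grad psi z))^-1 *
  \sum_(i < n) \sum_(j < n)
    grad psi z ord0 i * grad psi z ord0 j * hess psi z i j.

(* For a real symmetric matrix of size n > 0 the set of eigenvalues is finite
   and nonempty, so this supremum is a maximum. *)
Definition max_eigenvalue (X : 'M[R]_n) : R :=
  sup [set a : R | eigenvalue X a].

(* C^2 on an open set Omega; values of psi outside Omega are irrelevant.  The
   directions v, w range over all of R^n x R, the coordinate ones included. *)
Definition C2_on (Omega : set (spacetime R n)) psi : Prop :=
  forall z, Omega z ->
    [/\ {for z, continuous psi},
        forall v, derivable psi z v /\ {for z, continuous ('D_v psi)}
      & forall v w, derivable ('D_v psi) z w /\
                    {for z, continuous ('D_w ('D_v psi))}].

End calculus.

Section perron.
Context {R : realType} {n : nat}.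
Implicit Types (Omega : set (spacetime R n)) (u v : spacetime R n -> \bar R)
  (f : spacetime R n -> R) (z : spacetime R n).

Definition boundary Omega : set (spacetime R n) :=
  closure Omega `\` interior Omega.

(* Functions on Omega are represented by total functions of which only the
   values on Omega matter. *)
Definition usc_on Omega u : Prop :=
  forall z (a : R), Omega z -> (u z < a%:E)%E ->
    \forall y \near within Omega (nbhs z), (u y < a%:E)%E.

(* [u - psi] takes values in R \cup {-oo} on Omega, as u does. *)
Definition has_max_at Omega u (psi : spacetime R n -> R) z0 : Prop :=
  Omega z0 /\
  forall z, Omega z -> (u z - (psi z)%:E <= u z0 - (psi z0)%:E)%E.

Definition subsolution Omega u : Prop :=
  [/\ forall z, Omega z -> u z != +oo%E,
      usc_on Omega u
    & forall (psi : spacetime R n -> R) z0,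
        C2_on Omega psi -> has_max_at Omega u psi z0 ->
        (grad psi z0 != 0 -> dt psi z0 - norm_inf_laplacian psi z0 <= 0) /\
        (grad psi z0 = 0 -> dt psi z0 - max_eigenvalue (hess psi z0) <= 0)].

Definition lower_class Omega f : set (spacetime R n -> \bar R) :=
  [set v | subsolution Omega v /\
     forall z, boundary Omega z ->
       (limf_esup v (within Omega (nbhs z)) <= (f z)%:E)%E].

Definition lower_perron Omega f z : \bar R :=
  ereal_sup [set v z | v in lower_class Omega f].

Definition regular_point Omega z0 : Prop :=
  boundary Omega z0 /\
  forall f, {within boundary Omega, continuous f} ->
    lower_perron Omega f z @[z --> within Omega (nbhs z0)] --> (f z0)%:E.

End perron.

Definition petrovsky_domain (R : realType) (n : nat) (c : R) :
    set (spacetime R n) :=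
  [set z | [/\ - c < z.2, z.2 < 0 &
     sqnorm z.1 < - 4 * z.2 * ln `| ln `| z.2 | | ]].
Arguments petrovsky_domain {R} n c.

(* Main.v *)
Require Import Defs.
From HB Require Import structures.
From mathcomp Require Import all_boot all_order all_algebra.
From mathcomp Require Import all_classical all_reals all_analysis.
From mathcomp Require Import ring lra.
Set Implicit Arguments.
Unset Strict Implicit.
Unset Printing Implicit Defensive.
Import Order.TTheory GRing.Theory Num.Theory.
Import numFieldNormedType.Exports.
Local Open Scope classical_set_scope.
Local Open Scope ring_scope.

(* For a function of [r = |x|] and [t] the equation is the one-dimensional heat
   equation [u_t = u_rr].  With [s = - ln (- t)] the function
     [W = s^(-1/4) * (1 - exp (r^2 / (-4 t)) / (2 s))]
   is a smooth strict supersolution for -1 < t < 0.  In the domain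
   [exp (r^2 / (-4 t)) < s], hence [s^(-1/4) / 2 <= W <= s^(-1/4)], so [W] tends
   to 0 at the origin and is bounded below by a positive constant on the rest
   of the closure away from it.

   Upper bound: [f(0) + eps + K W] dominates [f] on the boundary for [K] large and
   is a C^2 test function, so the maximum principle puts every element of the
   lower class below it.

   Lower bound: [f(0) - 2 eps - K W + (eps / 3) |x|] belongs to the lower class.
   It is the maximum over the unit vectors [e] of smooth functions of
   [(x . e, t)]; touching a test function with one of these gives the required
   inequality when [x != 0], and for [x = 0] two opposite vectors [e] prescribe
   incompatible gradients, so that no test function touches there. *)

(** * Directional derivatives *)

Section directional.
Context {R : realType} {V : normedModType R}.
Implicit Types (f : V -> R) (x v w : V).

Lemma is_derive_lineP f x v (s df : R) :
  is_derive (s *: v + x) v f df <->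
  is_derive s (1 : R) (fun h => f (h *: v + x)) df.
Proof.
have E : (fun h : R => h^-1 *: ((f \o shift (s *: v + x)) (h *: v)
            - f (s *: v + x))) =
  (fun h => h^-1 *: (((fun h => f (h *: v + x)) \o shift s) (h *: (1 : R))
            - f (s *: v + x))).
  by apply/funext => h /=; rewrite [_%:A]mulr1 scalerDl addrA.
by split=> -[Hd <-]; (split; [move: Hd|]); rewrite /derivable /derive ?E.
Qed.

Lemma is_derive_scale_dir f x v (a df : R) :
  is_derive x v f df -> is_derive x (a *: v) f (a * df).
Proof.
move=> H.
have {}H : is_derive (0 : R) (1 : R) (fun h => f (h *: v + x)) df.
  by apply/is_derive_lineP; rewrite scale0r add0r.
suff : is_derive (0 *: (a *: v) + x) (a *: v) f (a * df).
  by rewrite scale0r add0r.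
apply/is_derive_lineP.
have -> : (fun h : R => f (h *: (a *: v) + x)) =
   (fun h => f (h *: v + x)) \o (fun h : R => a *: h).
  by apply/funext => h /=; rewrite scalerA mulrC.
rewrite mulrC; apply: is_derive1_comp; rewrite ?scaler0 //.
by apply: is_derive_eq; rewrite [LHS]mulr1.
Qed.

Lemma mvt_dir f x v :
  (forall s : R, 0 <= s <= 1 -> derivable f (s *: v + x) v) ->
  exists2 s : R, 0 <= s <= 1 & f (v + x) - f x = 'D_v f (s *: v + x).
Proof.
move=> df.
have dl (s : R) : 0 <= s <= 1 ->
    is_derive s (1 : R) (fun h => f (h *: v + x)) ('D_v f (s *: v + x)).
  by move=> /df/derivableP/is_derive_lineP.
have [//|s||s] := @MVT R (fun h => f (h *: v + x)) (fun s => 'D_v f (s *: v + x)) 0 1.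
- by rewrite in_itv /= => /andP[/ltW s0 /ltW s1]; apply: dl; rewrite s0.
- apply: derivable_within_continuous => s; rewrite in_itv /= => s01.
  by have [] := dl _ s01.
rewrite in_itv /= => /andP[/ltW s0 /ltW s1].
rewrite scale1r scale0r add0r subr0 mulr1 => ->; exists s => //.
by rewrite s0.
Qed.

(** [C2_on] provides continuous directional derivatives only, so additivity in the direction needs
    an argument. The increment along [h *: (v + w)] is split at [h *: v + x]; by the mean value
    theorem the second difference quotient is a value of ['D_w f] near [x], and continuity gives its
    limit. *)
Lemma is_derive_add_dir f x v w :
  derivable f x v -> (\forall y \near x, derivable f y w) ->
  {for x, continuous ('D_w f)} ->
  is_derive x (v + w) f ('D_v f x + 'D_w f x).
Proof.
move=> dv dw cw.
suff H : (fun h : R => h^-1 *: ((f \o shift x) (h *: (v + w)) - f x)) @ 0^' -->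
    'D_v f x + 'D_w f x.
  split; last exact: cvg_lim.
  by apply/cvg_ex; exists ('D_v f x + 'D_w f x).
have -> : (fun h : R => h^-1 *: ((f \o shift x) (h *: (v + w)) - f x)) =
  (fun h => h^-1 *: ((f \o shift x) (h *: v) - f x) +
            h^-1 *: (f (h *: w + (h *: v + x)) - f (h *: v + x))).
  apply/funext => h /=; rewrite -scalerDr; congr (_ *: _).
  by rewrite scalerDr (addrC (h *: v)) -addrA; lra.
apply: cvgD; first by [].
apply/cvgrPdist_lt => e e0.
have := filterI dw ((cvgrPdist_lt _ _).1 cw _ e0).
rewrite /= -nbhs_nearE nbhs_ballP => -[d /= d0 Hd].
(* The broken path stays within |h| times this constant of [x]; the summand 1 keeps it positive when
   [v = w = 0]. *)
have M0 : 0 < `|v| + `|w| + 1 by rewrite ltr_wpDl// addr_ge0.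
near=> h.
have h0 : h != 0 by near: h; exact: nbhs_dnbhs_neq.
have hd : `|h| * (`|v| + `|w| + 1) < d.
  rewrite -ltr_pdivlMr//; near: h; apply: nbhs_dnbhs.
  apply/nbhs_ballP; exists (d / (`|v| + `|w| + 1)); first by rewrite /= divr_gt0.
  by move=> h; rewrite /ball /= sub0r normrN.
have inb (s : R) : 0 <= s <= 1 -> ball x d (s *: (h *: w) + (h *: v + x)).
  move=> /andP[s0 s1]; rewrite -ball_normE /ball_ /=.
  rewrite distrC addrA addrK; apply: le_lt_trans hd.
  apply: le_trans (ler_normD _ _) _; rewrite !normrZ ger0_norm//.
  have := normr_ge0 v; have := normr_ge0 w; have h1 := normr_ge0 h => wg vg.
  rewrite mulrCA -mulrDr ler_wpM2l// -lerBlDr; nra.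
have [s s01|s s01] := @mvt_dir f (h *: v + x) (h *: w).
  have [H _] := Hd _ (inb _ s01).
  by have [] := is_derive_scale_dir h (derivableP H).
have [H1 H2] := Hd _ (inb _ s01).
move=> ->; rewrite (derive_val (is_derive := is_derive_scale_dir h (derivableP H1))).
by rewrite -[h^-1 *: _]/(h^-1 * _) mulKf.
Unshelve. all: by end_near. Qed.

Lemma derive_sum_dir f x (Omega : set V) n (a : 'I_n -> R) (v : 'I_n -> V) :
  open Omega -> Omega x -> 
  (forall y, Omega y -> forall w, derivable f y w) ->
  (forall w, {for x, continuous ('D_w f)}) ->
  'D_(\sum_i a i *: v i) f x = \sum_i a i * 'D_(v i) f x.
Proof.
move=> oO Ox df cf.
have nO : \forall y \near x, Omega y by exact: open_nbhs_nbhs.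
elim/big_rec2: _ => [|i d w _ <-]; first by rewrite derive0.
have H : \forall y \near x, derivable f y w by apply: filterS nO => y /df.
rewrite (derive_val (is_derive := is_derive_add_dir (df _ Ox _) H (cf _))).
by rewrite (derive_val (is_derive := is_derive_scale_dir _ (derivableP (df _ Ox _)))).
Qed.

End directional.

(** * Second-order necessary condition at a minimum *)

Section second_order_test.
Context {R : realType}.

(** The first claim is Fermat's rule. If [d] were negative, the difference quotients would make [h1]
    negative just to the right of 0, and the mean value theorem would push [h] below [h 0]. *)
Lemma local_min_derive2 (h h1 : R -> R) (d e : R) : 0 < e ->
  (forall s, `|s| < e -> is_derive s (1 : R) h (h1 s)) ->
  is_derive (0 : R) (1 : R) h1 d ->
  (forall s, `|s| < e -> h 0 <= h s) ->
  h1 0 = 0 /\ 0 <= d.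
Proof.
move=> e0 dh [dh1 <-] hmin.
have e_itv (s : R) : s \in `]- e, e[%R = (`|s| < e).
  by rewrite in_itv /= ltr_norml.
have h10 : h1 0 = 0.
  have H0 : `|0 : R| < e by rewrite normr0.
  rewrite -(derive_val (is_derive := dh _ H0)).
  have := @derive1_at_min R h (- e) e 0.
  rewrite e_itv => H.
  apply: (derive_val (is_derive := H _ _ _ _)) => //; first lra.
    by move=> t; rewrite e_itv => /dh [].
  by move=> t; rewrite e_itv; exact: hmin.
split=> //; rewrite leNgt; apply/negP => d0.
have /(cvgr_lt _) H : (fun k : R => k^-1 *: ((h1 \o shift 0) (k *: (1 : R)) - h1 0)) @ 0^' -->
  'D_1 h1 0 by exact: dh1.
have := H 0 d0; rewrite /= near_withinE => /nbhs_ballP[r /= r0 Hr].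
pose s := Num.min r e / 2.
have m0 : 0 < Num.min r e by rewrite lt_min r0.
have s0 : 0 < s by rewrite divr_gt0.
have sm : s < Num.min r e by rewrite /s; lra.
have /andP[sr se] : (s < r) && (s < e) by rewrite -lt_min.
have [||c] := @MVT R h h1 0 s s0.
- move=> x; rewrite in_itv /= => /andP[x0 x1]; apply: dh.
  by rewrite gtr0_norm// (lt_trans x1).
- apply: derivable_within_continuous => x; rewrite in_itv /= => /andP[x0 x1].
  have xe : `|x| < e by rewrite ger0_norm// (le_lt_trans x1).
  by have [] := dh _ xe.
rewrite in_itv /= => /andP[c0 c1] E.
have := Hr c; rewrite /ball /= sub0r normrN gtr0_norm// (lt_trans c1 sr).
move=> /(_ isT); rewrite gt_eqF// => /(_ isT).
rewrite addr0 [_%:A]mulr1 h10 subr0 -[_ *: _]/(c^-1 * _).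
rewrite pmulr_rlt0 ?invr_gt0// => h1c.
have := hmin s; rewrite gtr0_norm// => /(_ se).
rewrite -subr_ge0 E; nra.
Qed.

Lemma min_derive2 (V : normedModType R) (Omega : set V) (phi phi1 : V -> R) z v d :
  open Omega -> Omega z -> (forall y, Omega y -> is_derive y v phi (phi1 y)) ->
  is_derive z v phi1 d -> (forall y, Omega y -> phi z <= phi y) ->
  phi1 z = 0 /\ 0 <= d.
Proof.
move=> oO Oz d1 d2 zmin.
have : \forall s \near (0 : R), Omega (s *: v + z).
  have : (fun s : R => s *: v + z) @ 0 --> 0 *: v + z.
    by apply: cvgD; [apply: cvgZr_tmp|exact: cvg_cst].
  by rewrite scale0r add0r; apply; exact: open_nbhs_nbhs.
move=> /nbhs_ballP[e /= e0 He].
have inO s : `|s| < e -> Omega (s *: v + z).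
  by move=> se; apply: He; rewrite /ball /= sub0r normrN.
have := @local_min_derive2 (fun s => phi (s *: v + z))
  (fun s => phi1 (s *: v + z)) d e e0.
rewrite scale0r add0r; apply.
- by move=> s /inO/d1/is_derive_lineP.
- by apply: (is_derive_lineP phi1 z v 0 d).1; rewrite scale0r add0r.
- by move=> s /inO/zmin.
Qed.

End second_order_test.

(** * Second-order jets *)

Section jets.
Context {R : realType} {V : normedModType R}.
Implicit Types (D : set V) (z v w : V).

(** [f1] and [f2] are carried as explicit formulas, so jets of composite functions are assembled by
    the rules below and then simplified. Full differentiability, rather than directional, is what
    makes these rules compose. *)
Definition jet2 D (f : V -> R) (f1 : V -> V -> R) (f2 : V -> V -> V -> R) : Prop :=
  forall z, D z ->
    [/\ is_diff z f (f1 z),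
        forall v, is_diff z (f1 ^~ v) (f2 z v)
      & forall v w, {for z, continuous (fun y => f2 y v w)}].

Lemma is_diff_linear (f : V -> R) z : linear f -> continuous f -> is_diff z f f.
Proof.
move=> lf cf.
pose m := GRing.isLinear.Build _ _ _ _ _ lf.
pose F : {linear V -> R} := HB.pack f m.
split; first by apply: (@linear_differentiable _ _ _ F); exact: cf.
by apply: (@diff_lin _ _ _ F); exact: cf.
Qed.

Lemma jet2_linear D (f : V -> R) : linear f -> continuous f ->
  jet2 D f (fun _ v => f v) (fun _ _ _ => 0).
Proof.
move=> lf cf z _; split; first exact: is_diff_linear.
  by move=> v; exact: is_diff_cst.
by move=> v w; exact: cst_continuous.
Qed.

Lemma jet2_cst D (a : R) : jet2 D (fun=> a) (fun _ _ => 0) (fun _ _ _ => 0).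
Proof.
move=> z _; split; [exact: is_diff_cst|move=> v; exact: is_diff_cst|].
by move=> v w; exact: cst_continuous.
Qed.

Lemma jet2D D f f1 f2 g g1 g2 : jet2 D f f1 f2 -> jet2 D g g1 g2 ->
  jet2 D (fun z => f z + g z) (fun z v => f1 z v + g1 z v)
    (fun z v w => f2 z v w + g2 z v w).
Proof.
move=> jf jg z Dz; have [a1 a2 a3] := jf z Dz; have [b1 b2 b3] := jg z Dz.
split; first exact: (is_diffD a1 b1).
  by move=> v; exact: (is_diffD (a2 v) (b2 v)).
by move=> v w; exact: cvgD (a3 v w) (b3 v w).
Qed.

Lemma jet2M D f f1 f2 g g1 g2 : jet2 D f f1 f2 -> jet2 D g g1 g2 ->
  jet2 D (fun z => f z * g z) (fun z v => f z * g1 z v + g z * f1 z v)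
    (fun z v w => f z * g2 z v w + g1 z v * f1 z w
                + (g z * f2 z v w + f1 z v * g1 z w)).
Proof.
move=> jf jg z Dz; have [a1 a2 a3] := jf z Dz; have [b1 b2 b3] := jg z Dz.
have cd (h dh : V -> R) : is_diff z h dh -> {for z, continuous h}.
  by move=> H; apply: differentiable_continuous; exact: ex_diff.
split; first exact: (is_diffM a1 b1).
  move=> v; exact: (is_diffD (is_diffM a1 (b2 v)) (is_diffM b1 (a2 v))).
move=> v w.
have := (cvgD (cvgD (cvgM (cd _ _ a1) (b3 v w)) (cvgM (cd _ _ (b2 v)) (cd _ _ (a2 w))))
  (cvgD (cvgM (cd _ _ b1) (a3 v w)) (cvgM (cd _ _ (a2 v)) (cd _ _ (b2 w))))).
exact.
Qed.

Lemma is_derive_diff (phi : R -> R) (y d : R) :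
  is_derive y (1 : R) phi d -> is_diff y phi (fun h => d * h).
Proof.
move=> [dphi <-]; split; first exact/derivable1_diffP.
by rewrite deriv1E//; apply/funext => h; rewrite derive1E mulrC.
Qed.

(** [E] is where [phi] is smooth: the interval -1 < t < 0 for functions of time, the whole line for
    [expR]. *)
Lemma jet2_comp D (E : set R) f f1 f2 (phi phi1 phi2 : R -> R) :
  (forall z, D z -> E (f z)) -> jet2 D f f1 f2 ->
  (forall y, E y -> [/\ is_derive y (1 : R) phi (phi1 y),
     is_derive y (1 : R) phi1 (phi2 y) & {for y, continuous phi2}]) ->
  jet2 D (fun z => phi (f z)) (fun z v => phi1 (f z) * f1 z v)
    (fun z v w => phi1 (f z) * f2 z v w + f1 z v * (phi2 (f z) * f1 z w)).
Proof.
move=> DE jf jphi z Dz; have [a1 a2 a3] := jf z Dz.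
have [/is_derive_diff p1 /is_derive_diff p2 p3] := jphi _ (DE z Dz).
have cd (W : normedModType R) (h dh : W -> R) y : is_diff y h dh -> {for y, continuous h}.
  by move=> H; apply: differentiable_continuous; exact: ex_diff.
have c1 := is_diff_comp a1 p1; have c2 := is_diff_comp a1 p2.
split; first by [].
  by move=> v; exact: (is_diffM c2 (a2 v)).
move=> v w.
have k1 : {for z, continuous (phi1 \o f)} := cd _ _ _ _ c2.
have k2 : {for z, continuous (phi2 \o f)}.
  by apply: continuous_comp; [exact: cd a1|exact: p3].
have := (cvgD (cvgM k1 (a3 v w)) (cvgM (cd _ _ _ _ (a2 v))
   (cvgM k2 (cd _ _ _ _ (a2 w))))).
exact.
Qed.

Lemma jet2_eq D (f g : V -> R) f1 f2 g1 g2 : jet2 D f f1 f2 ->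
  f =1 g -> f1 =2 g1 -> (forall z v, f2 z v =1 g2 z v) -> jet2 D g g1 g2.
Proof.
move=> jf /funext <- E1 E2.
have <- : f1 = g1 by do 2 apply/funext => ?; exact: E1.
by have <- : f2 = g2 by do 3 apply/funext => ?; exact: E2.
Qed.

Lemma jet2_sum D n (f : 'I_n -> V -> R) f1 f2 :
  (forall i, jet2 D (f i) (f1 i) (f2 i)) ->
  jet2 D (fun z => \sum_i f i z) (fun z v => \sum_i f1 i z v)
    (fun z v w => \sum_i f2 i z v w).
Proof.
elim: n f f1 f2 => [|n IH] f f1 f2 jf.
  apply: (@jet2_eq D (fun=> 0) _ (fun _ _ => 0) (fun _ _ _ => 0)).
  - exact: jet2_cst.
  - by move=> z; rewrite big_ord0.
  - by move=> z v; rewrite big_ord0.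
  - by move=> z v w; rewrite big_ord0.
have := jet2D (jf ord0) (IH _ _ _ (fun i => jf (lift ord0 i))).
move=> /(@jet2_eq D); apply.
- by move=> z; rewrite big_ord_recl.
- by move=> z v; rewrite big_ord_recl.
- by move=> z v w; rewrite big_ord_recl.
Qed.

Lemma jet2_continuous D f f1 f2 z : jet2 D f f1 f2 -> D z -> {for z, continuous f}.
Proof.
by move=> jf /jf[d _ _]; apply: differentiable_continuous; exact: ex_diff.
Qed.

Lemma jet2_is_derive D f f1 f2 z v : jet2 D f f1 f2 -> D z ->
  is_derive z v f (f1 z v).
Proof.
move=> jf /jf[[df e1] _ _]; split; first exact: diff_derivable.
by rewrite deriveE// e1.
Qed.

Lemma jet2_is_derive2 D f f1 f2 z v w : jet2 D f f1 f2 -> D z ->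
  is_derive z w (f1 ^~ v) (f2 z v w).
Proof.
move=> jf /jf[_ /(_ v)[df e1] _]; split; first exact: diff_derivable.
by rewrite deriveE// e1.
Qed.

Lemma jet2_derive D f f1 f2 z v : jet2 D f f1 f2 -> D z -> 'D_v f z = f1 z v.
Proof. by move=> jf /(jet2_is_derive v jf)[]. Qed.

Lemma jet2_near_derive D f f1 f2 z v : open D -> jet2 D f f1 f2 -> D z ->
  \forall y \near z, f1 y v = 'D_v f y.
Proof.
move=> oD jf Dz.
have : \forall y \near z, D y by exact: open_nbhs_nbhs.
by apply: filterS => y /(jet2_derive v jf).
Qed.

Lemma jet2_is_derive2D D f f1 f2 z v w : open D -> jet2 D f f1 f2 -> D z ->
  is_derive z w ('D_v f) (f2 z v w).
Proof.
move=> oD jf Dz.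
exact: near_eq_is_derive (jet2_near_derive v oD jf Dz) (jet2_is_derive2 v w jf Dz).
Qed.

End jets.

(** * The radial barrier *)

Section profile.
Context {R : realType}.
Implicit Types (t q : R).

(** This is ln s for s = - ln (- t), so s^a appears below as [expR (a * loglog t)]. *)
Definition loglog t : R := ln (- ln (- t)).
Definition loglog1 t : R := (t * ln (- t))^-1.
Definition loglog2 t : R := - (ln (- t) + 1) * loglog1 t ^+ 2.

(** [q * scale t] is r^2 / (-4 t) = y^2; the lateral boundary of the domain is where it equals
    [loglog t]. *)
Definition scale t : R := (- (4 * t))^-1.
Definition scale1 t : R := (4 * t ^+ 2)^-1.
Definition scale2 t : R := - (2 * t ^+ 3)^-1.

Lemma ln_opp_lt0 t : -1 < t < 0 -> ln (- t) < 0.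
Proof. by move=> /andP[t1 t0]; apply: ln_lt0; lra. Qed.

Lemma is_derive_ln_opp t : t < 0 -> is_derive t (1 : R) (fun y => ln (- y)) t^-1.
Proof.
move=> t0; have lt : 0 < - t by lra.
have := @is_derive1_comp R (@ln R) -%R t _ _ (is_derive1_ln lt) (is_deriveNid t 1).
by rewrite mulrN1 invrN opprK.
Qed.

Lemma loglog_derive t : -1 < t < 0 ->
  [/\ is_derive t (1 : R) loglog (loglog1 t),
      is_derive t (1 : R) loglog1 (loglog2 t) & {for t, continuous loglog2}].
Proof.
move=> tI; have l0 := ln_opp_lt0 tI; have /andP[_ t0] := tI.
have ls : 0 < - ln (- t) by lra.
have dl := is_derive_ln_opp t0.
have tl : t * ln (- t) != 0 by rewrite mulf_neq0// lt_eqF.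
have d1 : is_derive t (1 : R) loglog1 (loglog2 t).
  have := @is_deriveV R (fun y => y * ln (- y)) t _ 1 tl
    (is_deriveM (is_derive_id t 1) dl).
  move/is_derive_eq; apply; rewrite /loglog2 /loglog1 /GRing.scale /= .
  by field; rewrite lt_eqF//= lt_eqF.
split=> //.
  have := @is_derive1_comp R (@ln R) (fun y => - ln (- y)) t _ _ (is_derive1_ln ls) (is_deriveN dl).
  move/is_derive_eq; apply; rewrite /loglog1.
  by field; rewrite lt_eqF//= lt_eqF.
have cd (h : R -> R) d : is_derive t (1 : R) h d -> {for t, continuous h}.
  by move=> [] /derivable1_diffP/differentiable_continuous.
rewrite /loglog2; apply: cvgM; last by apply: cvgM; exact: cd d1.
by apply: cvgN; apply: cvgD; [exact: cd dl|exact: cvg_cst].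
Qed.

Lemma scale_derive t : -1 < t < 0 ->
  [/\ is_derive t (1 : R) scale (scale1 t),
      is_derive t (1 : R) scale1 (scale2 t) & {for t, continuous scale2}].
Proof.
move=> /andP[_ t0]; have tN0 : t != 0 by rewrite lt_eqF.
have di := is_derive_id t (1 : R).
split.
- have H : - (4 * t) != 0 by rewrite oppr_eq0 mulf_neq0.
  have := @is_deriveV R (fun y => - (4 * y)) t _ 1 H
    (is_deriveN (is_deriveM (is_derive_cst (4 : R) t (1 : R)) di)).
  move/is_derive_eq; apply; rewrite /scale1 /GRing.scale /= /cst; field; exact: tN0.
- have H : 4 * t ^+ 2 != 0 by rewrite mulf_neq0// expf_neq0.
  have := @is_deriveV R (fun y => 4 * y ^+ 2) t _ 1 H
    (is_deriveM (is_derive_cst (4 : R) t (1 : R)) (is_deriveX 2 di)).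
  move/is_derive_eq; apply; rewrite /scale2 /GRing.scale /= /cst; field; exact: tN0.
- rewrite /scale2; apply: cvgN; apply: cvgV; first by rewrite mulf_neq0// expf_neq0.
  by apply: cvgM; [exact: cvg_cst|exact: exprn_continuous].
Qed.

Lemma expR_derive t :
  [/\ is_derive t (1 : R) expR (expR t),
      is_derive t (1 : R) expR (expR t) & {for t, continuous (@expR R)}].
Proof. by split; [exact: is_derive_expR..|exact: continuous_expR]. Qed.

(* In the variables [s = - ln (- t)] and [y = r / sqrt (- 4 t)] the equation
   [u_t = u_rr] reads [4 u_s = u_yy - 2 y u_y], whose right-hand side maps
   [expR (y ^+ 2)] to [2 * expR (y ^+ 2)]; this dictates the exponents of [s].
   The argument [q] stands for [r ^+ 2]. *)
Definition profile_exp q t := expR (q * scale t + - (5 / 4) * loglog t).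

(** The barrier W, expanded: s^(-1/4) times exp (y^2) / s gives the exponent -5/4 in
    [profile_exp]. *)
Definition profile q t :=
  expR (- (1 / 4) * loglog t) + - (1 / 2) * profile_exp q t.

Definition profile_t q t :=
  - (1 / 4) * loglog1 t * expR (- (1 / 4) * loglog t)
  - 1 / 2 * profile_exp q t * (q * scale1 t - 5 / 4 * loglog1 t).

(* second derivative in [r] where [q = r ^+ 2] *)
Definition profile_rr q t :=
  - (1 / 2) * profile_exp q t * (4 * q * scale t ^+ 2 + 2 * scale t).

Lemma scale_gt0 t : -1 < t < 0 -> 0 < scale t.
Proof. by move=> /andP[_ t0]; rewrite invr_gt0; lra. Qed.

Lemma expR_loglog_split t : -1 < t < 0 ->
  expR (- (1 / 4) * loglog t) = - ln (- t) * expR (- (5 / 4) * loglog t).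
Proof.
move=> /ln_opp_lt0 l0.
have {1}-> : - ln (- t) = expR (loglog t) by rewrite lnK// posrE; lra.
by rewrite -expRD; congr expR; field.
Qed.

Lemma profile_expE q t :
  profile_exp q t = expR (q * scale t) * expR (- (5 / 4) * loglog t).
Proof. by rewrite -expRD. Qed.

(** With E = exp (y^2), the terms having [q] as a factor cancel because [scale1] is 4 times the
    square of [scale]. There remains s^(-5/4) / (-t) * ((E - 1) / 4 + 5 E / (8 s)), which is
    positive since E >= 1. *)
Lemma profile_heat_supersolution q t : 0 <= q -> -1 < t < 0 ->
  profile_rr q t < profile_t q t.
Proof.
move=> q0 tI; have l0 := ln_opp_lt0 tI; have /andP[_ t0] := tI.
rewrite -subr_gt0 /profile_t /profile_rr expR_loglog_split// profile_expE.
set E := expR (q * _); set b := expR _.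
have b0 : 0 < b by exact: expR_gt0.
have E1 : 1 <= E.
  by rewrite -expR0 ler_expR mulr_ge0// ltW// scale_gt0.
rewrite [ltRHS](_ : _ = b * (- t)^-1 * ((E - 1) / 4 + 5 / 8 * E / (- ln (- t)))).
  apply: mulr_gt0; first by rewrite mulr_gt0// invr_gt0; lra.
  apply: ltr_wpDl; first by rewrite divr_ge0//; lra.
  by rewrite divr_gt0//; lra.
rewrite /loglog1 /scale1 /scale.
by field; rewrite lt_eqF//= lt_eqF.
Qed.

(** Together with the Cauchy-Schwarz inequality this puts the directional lower barriers below the
    radial one. *)
Lemma profile_le q q' t : -1 < t < 0 -> q <= q' -> profile q' t <= profile q t.
Proof.
move=> tI qq'; rewrite lerD2l ler_nM2l; last lra.
by rewrite ler_expR lerD2r ler_wpM2r// ltW// scale_gt0.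
Qed.

Lemma profile_le_decay q t : profile q t <= expR (- (1 / 4) * loglog t).
Proof. by rewrite gerDl mulr_le0_ge0 ?expR_ge0//; lra. Qed.

(** The hypothesis says exp (y^2) <= s, so the subtracted term is at most half of s^(-1/4). *)
Lemma profile_ge q t : -1 < t < 0 -> q * scale t <= loglog t ->
  1 / 2 * expR (- (1 / 4) * loglog t) <= profile q t.
Proof.
move=> tI qt; rewrite /profile.
have : profile_exp q t <= expR (- (1 / 4) * loglog t).
  by rewrite ler_expR; lra.
lra.
Qed.

End profile.

(** * Space-time barriers and their derivatives *)

Section barrier.
Context {R : realType} {n : nat}.
Notation ST := (spacetime R n).
Implicit Types (z v w : ST) (e x y : 'rV[R]_n).

Definition dot x y : R := \sum_(i < n) x ord0 i * y ord0 i.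

Lemma dotC x y : dot x y = dot y x.
Proof. by apply: eq_bigr => i _; rewrite mulrC. Qed.

Lemma dot0l x : dot 0 x = 0.
Proof. by rewrite /dot big1// => i _; rewrite mxE mul0r. Qed.

Lemma dot_sqnorm x : dot x x = sqnorm x.
Proof. by apply: eq_bigr => i _; rewrite expr2. Qed.

Lemma dot_delta x i : dot x (delta_mx ord0 i) = x ord0 i.
Proof.
rewrite /dot (bigD1 i)//= big1 ?addr0; first by rewrite mxE !eqxx mulr1.
by move=> j ji; rewrite mxE (negbTE ji) andbF mulr0.
Qed.

Lemma dotZl (a : R) x y : dot (a *: x) y = a * dot x y.
Proof. by rewrite /dot mulr_sumr; apply: eq_bigr => i _; rewrite mxE mulrA. Qed.

Lemma dotZr (a : R) x y : dot x (a *: y) = a * dot x y.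
Proof. by rewrite dotC dotZl dotC. Qed.

Lemma sqnorm_ge0 x : 0 <= sqnorm x.
Proof. by apply: sumr_ge0 => i _; exact: sqr_ge0. Qed.

Lemma sqnormZ (a : R) x : sqnorm (a *: x) = a ^+ 2 * sqnorm x.
Proof. by rewrite -!dot_sqnorm dotZl dotZr mulrA expr2. Qed.

Lemma sqnorm_eq0 x : (sqnorm x == 0) = (x == 0).
Proof.
apply/eqP/eqP => [|->]; last by rewrite -dot_sqnorm dot0l.
move=> /eqP; rewrite psumr_eq0; last by move=> i _; exact: sqr_ge0.
move=> /allP H; apply/rowP => i; rewrite mxE.
by have := H i (mem_index_enum _); rewrite sqrf_eq0 => /eqP.
Qed.

(** The difference of the two sides is the squared length of the component of [x] orthogonal to
    [e]. *)
Lemma cauchy_schwarz x e : sqnorm e = 1 -> dot x e ^+ 2 <= sqnorm x.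
Proof.
move=> e1; have := sqnorm_ge0 (x - dot x e *: e).
suff -> : sqnorm (x - dot x e *: e) = sqnorm x - dot x e ^+ 2 by rewrite subr_ge0.
rewrite /sqnorm (eq_bigr (fun i => x ord0 i ^+ 2 +
  (- (2 * dot x e) * (x ord0 i * e ord0 i) + dot x e ^+ 2 * e ord0 i ^+ 2))).
  rewrite !big_split/= -!mulr_sumr -/(dot x e) -/(sqnorm e) e1; ring.
by move=> i _; rewrite !mxE; ring.
Qed.

Lemma linear_fst_dot e : linear (fun z : ST => dot z.1 e).
Proof.
move=> a z w; rewrite /dot scaler_sumr -big_split; apply: eq_bigr => i _ /=.
by rewrite !mxE mulrDl -mulrA.
Qed.

Lemma continuous_fst_dot e : continuous (fun z : ST => dot z.1 e).
Proof.
move=> z; apply: cvg_big => [|i _]; first exact: add_continuous.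
apply: cvgM; last exact: cvg_cst.
have := @coord_continuous R 1 n ord0 i z.1.
by apply: continuous_comp; exact: cvg_fst.
Qed.

(** For t < 0 this is where - ln (- t) is positive, hence where [loglog] is smooth. *)
Definition slab : set ST := [set z | -1 < z.2 < 0].

Lemma open_slab : open slab.
Proof.
have -> : slab = snd @^-1` `]-1, 0[%classic.
  by apply/seteqP; split => z /=; rewrite in_itv.
by apply: open_comp; [move=> z _; exact: cvg_snd|exact: itv_open].
Qed.

Lemma jet2_time : jet2 slab (fun z => z.2) (fun _ v => v.2) (fun _ _ _ => 0).
Proof. by apply: jet2_linear => [a z w //|z]; exact: cvg_snd. Qed.

Lemma jet2_time_comp (phi phi1 phi2 : R -> R) :
  (forall t : R, -1 < t < 0 -> [/\ is_derive t (1 : R) phi (phi1 t),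
     is_derive t (1 : R) phi1 (phi2 t) & {for t, continuous phi2}]) ->
  jet2 slab (fun z => phi z.2) (fun z v => phi1 z.2 * v.2)
    (fun z v w => phi1 z.2 * 0 + v.2 * (phi2 z.2 * w.2)).
Proof.
by move=> H; apply: (jet2_comp (E := [set t : R | -1 < t < 0])) jet2_time H.
Qed.

Lemma jet2_expR (f : ST -> R) f1 f2 : jet2 slab f f1 f2 ->
  jet2 slab (fun z => expR (f z)) (fun z v => expR (f z) * f1 z v)
    (fun z v w => expR (f z) * f2 z v w + f1 z v * (expR (f z) * f1 z w)).
Proof.
by move=> jf; apply: (jet2_comp (E := setT)) jf _ => // t _; exact: expR_derive.
Qed.

Lemma jet2Z (a : R) (f : ST -> R) f1 f2 : jet2 slab f f1 f2 ->
  jet2 slab (fun z => a * f z) (fun z v => a * f1 z v) (fun z v w => a * f2 z v w).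
Proof.
move=> jf; have := jet2M (@jet2_cst _ _ slab a) jf.
move=> /(@jet2_eq _ _ slab); apply.
- by [].
- by move=> z v; rewrite mulr0 addr0.
- by move=> z v w; rewrite !(mul0r, mulr0, addr0, add0r).
Qed.

Lemma jet2_sqnorm : jet2 slab (fun z => sqnorm z.1)
  (fun z v => 2 * dot z.1 v.1) (fun _ v w => 2 * dot v.1 w.1).
Proof.
have jc i := @jet2_linear _ _ slab _ (linear_fst_dot (delta_mx ord0 i))
  (@continuous_fst_dot (delta_mx ord0 i)).
have := jet2_sum (fun i => jet2M (jc i) (jc i)).
move=> /(@jet2_eq _ _ slab); apply.
- by move=> z; apply: eq_bigr => i _ /=; rewrite dot_delta expr2.
- by move=> z v; rewrite [in RHS]/dot mulr_sumr; apply: eq_bigr => i _ /=; rewrite !dot_delta; ring.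
- by move=> z v w; rewrite [in RHS]/dot mulr_sumr; apply: eq_bigr => i _ /=; rewrite !dot_delta; ring.
Qed.

Lemma jet2_sqdot e : jet2 slab (fun z => dot z.1 e ^+ 2)
  (fun z v => 2 * dot z.1 e * dot v.1 e) (fun _ v w => 2 * dot v.1 e * dot w.1 e).
Proof.
have jc := @jet2_linear _ _ slab _ (linear_fst_dot e) (@continuous_fst_dot e).
have := jet2M jc jc; move=> /(@jet2_eq _ _ slab); apply.
- by move=> z; rewrite expr2.
- by move=> z v; ring.
- by move=> z v w; ring.
Qed.

(** The derivative of [profile (N z) z.2] along [v] by the chain rule. [N] is abstract so that both
    |x|^2 and (x . e)^2 can be inserted. *)
Definition barrier1 (N : ST -> R) (N1 : ST -> ST -> R) z v : R :=
  - (1 / 4) * loglog1 z.2 * expR (- (1 / 4) * loglog z.2) * v.2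
  - 1 / 2 * profile_exp (N z) z.2 *
     (scale z.2 * N1 z v + (N z * scale1 z.2 - 5 / 4 * loglog1 z.2) * v.2).

(** Only spatial second derivatives enter the equation, so [W2] stays existential and is evaluated
    only on directions without time component. *)
Lemma jet2_barrier (N : ST -> R) N1 N2 : jet2 slab N N1 N2 ->
  exists2 W2, jet2 slab (fun z => profile (N z) z.2) (barrier1 N N1) W2 &
  forall z v w, v.2 = 0 -> w.2 = 0 -> W2 z v w = - (1 / 2) *
    profile_exp (N z) z.2 *
    (scale z.2 ^+ 2 * N1 z v * N1 z w + scale z.2 * N2 z v w).
Proof.
move=> jN.
have jl := jet2_time_comp (@loglog_derive R).
have js := jet2_time_comp (@scale_derive R).
have := jet2D (jet2_expR (jet2Z (- (1 / 4)) jl))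
  (jet2Z (- (1 / 2)) (jet2_expR (jet2D (jet2M jN js) (jet2Z (- (5 / 4)) jl)))).
(* The witness is read off the type of [J] instead of being written out. *)
move=> J; match type of J with jet2 _ _ _ ?W2 => exists W2 end.
  move/(@jet2_eq _ _ slab): J; apply => // z v.
  by rewrite /barrier1 /profile_exp; ring.
by move=> z v w v0 w0; rewrite v0 w0 /profile_exp; ring.
Qed.

End barrier.

(** * Sub- and supersolutions *)

Section test_functions.
Context {R : realType} {n : nat}.
Notation ST := (spacetime R n).
Implicit Types (z v w y : ST) (e x : 'rV[R]_n) (psi : ST -> R).

Lemma near_eq_continuous_at (f g : ST -> R) z :
  (\forall y \near z, f y = g y) -> {for z, continuous f} -> {for z, continuous g}.
Proof.
move=> fg cf; rewrite /prop_for /continuous_at -(nbhs_singleton fg).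
by apply: cvg_trans cf; exact: near_eq_cvg.
Qed.

Lemma C2_on_jet2 (D : set ST) f f1 f2 : open D -> jet2 D f f1 f2 -> C2_on D f.
Proof.
move=> oD jf z Dz; have [a1 a2 a3] := jf z Dz; split.
- exact: jet2_continuous jf Dz.
- move=> v; split; first by have [] := jet2_is_derive v jf Dz.
  apply: near_eq_continuous_at (jet2_near_derive v oD jf Dz) _.
  by apply: differentiable_continuous; have [] := a2 v.
- move=> v w; split; first by have [] := jet2_is_derive2D v w oD jf Dz.
  apply: near_eq_continuous_at (a3 v w).
  have : \forall y \near z, D y by exact: open_nbhs_nbhs.
  by apply: filterS => y Dy; have [_ ->] := jet2_is_derive2D v w oD jf Dy.
Qed.

Lemma C2_on_subset (D E : set ST) psi : D `<=` E -> C2_on E psi -> C2_on D psi.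
Proof. by move=> DE H z /DE/H. Qed.

Lemma jet2_subset (D E : set ST) f f1 f2 :
  D `<=` E -> jet2 E f f1 f2 -> jet2 D f f1 f2.
Proof. by move=> DE H z /DE/H. Qed.

(** The difference [psi - f] has a minimum over [D] at [z], so the second-order test along [v]
    applies to it. *)
Lemma touching_jet2 (D : set ST) psi f f1 f2 z v : open D -> C2_on D psi ->
  jet2 D f f1 f2 -> D z -> (forall y, D y -> f y - psi y <= f z - psi z) ->
  'D_v psi z = f1 z v /\ f2 z v v <= 'D_v ('D_v psi) z.
Proof.
move=> oD Cpsi jf Dz zmax.
have d1 y : D y -> is_derive y v (psi - f) (('D_v psi - f1 ^~ v) y).
  move=> Dy; have [_ H _] := Cpsi y Dy; have [H1 _] := H v.
  exact: (is_deriveB (derivableP H1) (jet2_is_derive v jf Dy)).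
have d2 : is_derive z v ('D_v psi - f1 ^~ v) ('D_v ('D_v psi) z - f2 z v v).
  have [_ _ H] := Cpsi z Dz; have [H1 _] := H v v.
  exact: (is_deriveB (derivableP H1) (jet2_is_derive2 v v jf Dz)).
have [] := min_derive2 oD Dz d1 d2.
  by move=> y /zmax; rewrite /= -[(psi - f) z]/(psi z - f z) -[(psi - f) y]/(psi y - f y); lra.
by rewrite -[(_ - _ : _ -> _) z]/('D_v psi z - f1 z v) subr_ge0 => /subr0_eq.
Qed.

Lemma sum_dir_x e : \sum_i e ord0 i *: dir_x i = (e, 0) :> ST.
Proof.
rewrite [RHS]surjective_pairing /=.
have E : forall m (F : 'I_m -> ST), \sum_i F i = (\sum_i (F i).1, \sum_i (F i).2).
  move=> m F; elim/big_rec3: _ => // i a b _ _ ->.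
  by case: (F i).
rewrite E; congr pair.
  by rewrite [RHS]row_sum_delta.
by rewrite big1// => i _; rewrite /= scaler0.
Qed.

(** Touching controls second derivatives along a line, whereas the equation uses the Hessian matrix.
    The direction is expanded twice in coordinates; the inner expansion has to hold near [z], since
    it is differentiated again. *)
Lemma hess_quadratic (D : set ST) psi z e : open D -> C2_on D psi -> D z ->
  \sum_(i < n) \sum_(j < n) e ord0 i * e ord0 j * hess psi z i j =
  'D_((e, 0) : ST) ('D_((e, 0) : ST) psi) z.
Proof.
move=> oD Cpsi Dz; rewrite -sum_dir_x.
have d1 y (Dy : D y) w : derivable psi y w by have [_ /(_ w)[]] := Cpsi y Dy.
have c1 y (Dy : D y) w : {for y, continuous ('D_w psi)}.
  by have [_ /(_ w)[]] := Cpsi y Dy.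
have d2 v y (Dy : D y) w : derivable ('D_v psi) y w.
  by have [_ _ /(_ v w)[]] := Cpsi y Dy.
have c2 v y (Dy : D y) w : {for y, continuous ('D_w ('D_v psi))}.
  by have [_ _ /(_ v w)[]] := Cpsi y Dy.
set v : ST := \sum_i e ord0 i *: dir_x i.
have E : \forall y \near z,
    'D_v psi y = (\sum_i (e ord0 i *: ('D_(dir_x i) psi : ST -> R))) y.
  have : \forall y \near z, D y by exact: open_nbhs_nbhs.
  apply: filterS => y Dy.
  by rewrite /v (derive_sum_dir _ _ oD Dy d1 (c1 y Dy)) fct_sumE.
rewrite (near_eq_derive _ E) derive_sum; last first.
  by move=> i; apply: derivableZ; exact: d2.
apply: eq_bigr => i _; rewrite deriveZ; last exact: d2.
rewrite /v (derive_sum_dir _ _ oD Dz (d2 _) (c2 _ z Dz)) scaler_sumr.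
by apply: eq_bigr => j _; rewrite mxE -[_ *: _]/(_ * _) mulrA.
Qed.

End test_functions.

(** * Differential inequalities for the two barriers *)

Section sub_and_supersolutions.
Context {R : realType} {n : nat}.
Notation ST := (spacetime R n).
Notation slab := (@slab R n).
Implicit Types (z v w y : ST) (e x : 'rV[R]_n) (psi : ST -> R).

(** Serves at x = 0, where the Hessian of the radial barrier is a multiple of the identity.
    Positivity of [n] supplies an eigenvector. *)
Lemma max_eigenvalue_scalar (a : R) : (0 < n)%N ->
  max_eigenvalue (a%:M : 'M[R]_n) = a.
Proof.
move=> n0; rewrite /max_eigenvalue (_ : [set b | _] = [set a]) ?sup1//.
apply/seteqP; split => b /=.
  move=> /eigenvalueP[v]; rewrite mul_mx_scalar => E /eqP v0.
  have : (a - b) *: v == 0 by rewrite scalerBl E subrr.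
  by rewrite scaler_eq0 => /orP[|/eqP//]; rewrite subr_eq0 => /eqP.
move=> ->; apply/eigenvalueP; exists (delta_mx 0 (Ordinal n0)).
  by rewrite mul_mx_scalar.
apply/eqP => /rowP/(_ (Ordinal n0))/eqP.
by rewrite !mxE !eqxx oner_eq0.
Qed.

Definition upper_barrier (a K : R) z := a + K * profile (sqnorm z.1) z.2.

Lemma jet2_upper_barrier (a K : R) :
  exists2 W2, jet2 slab (upper_barrier a K)
      (fun z v => K * barrier1 (fun z => sqnorm z.1) (fun z v => 2 * dot z.1 v.1) z v) W2 &
  forall z v w, v.2 = 0 -> w.2 = 0 -> W2 z v w = - (K / 2) *
    profile_exp (sqnorm z.1) z.2 *
    (4 * scale z.2 ^+ 2 * dot z.1 v.1 * dot z.1 w.1 + 2 * scale z.2 * dot v.1 w.1).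
Proof.
have [W2 jW EW] := jet2_barrier (@jet2_sqnorm R n).
exists (fun z v w => K * W2 z v w).
  have := jet2D (@jet2_cst _ _ slab a) (jet2Z K jW).
  move=> /(@jet2_eq _ _ slab); apply => //.
  - by move=> z v; rewrite add0r.
  - by move=> z v w; rewrite add0r.
by move=> z v w v0 w0; rewrite EW//; field.
Qed.

Lemma C2_on_upper_barrier (a K : R) : C2_on slab (upper_barrier a K).
Proof.
by have [W2 jW _] := jet2_upper_barrier a K; exact: C2_on_jet2 (@open_slab R n) jW.
Qed.

(** The gradient is parallel to x, so the normalised Laplacian is the second radial derivative; at x
    = 0 the Hessian is scalar with that same derivative as its eigenvalue. Both cases reduce to
    [profile_heat_supersolution]. *)
Lemma upper_barrier_strict (a K : R) z : (0 < n)%N -> 0 < K -> slab z ->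
  (grad (upper_barrier a K) z != 0 ->
     0 < dt (upper_barrier a K) z - norm_inf_laplacian (upper_barrier a K) z) /\
  (grad (upper_barrier a K) z = 0 ->
     0 < dt (upper_barrier a K) z - max_eigenvalue (hess (upper_barrier a K) z)).
Proof.
move=> n0 K0 sz; have [W2 jW EW] := jet2_upper_barrier a K.
set F := upper_barrier a K; set q := sqnorm z.1.
have q0 : 0 <= q := sqnorm_ge0 z.1.
have kp := scale_gt0 sz.
set Eq := profile_exp q z.2; have Ep : 0 < Eq := expR_gt0 _.
have Edt : dt F z = K * profile_t q z.2.
  rewrite /dt (jet2_derive _ jW sz) /barrier1 /profile_t /dir_t /= dotC dot0l -/q.
  by rewrite -/Eq; ring.
(* The gradient will be [c] times x with [c] negative, so it vanishes exactly at x = 0. *)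
set c := - K * Eq * scale z.2.
have c0 : c < 0 by rewrite /c mulNr mulNr oppr_lt0 !mulr_gt0.
have Egrad : grad F z = c *: z.1.
  apply/rowP => i; rewrite !mxE (jet2_derive _ jW sz) /barrier1 /dir_x /= dot_delta -/q.
  by rewrite /c -/Eq; field.
have Ehess i j : hess F z i j = - (K / 2) * Eq *
    (4 * scale z.2 ^+ 2 * z.1 ord0 i * z.1 ord0 j + 2 * scale z.2 * (i == j)%:R).
  rewrite mxE; have [_ ->] := jet2_is_derive2D (dir_x i) (dir_x j) (@open_slab R n) jW sz.
  by rewrite EW// /dir_x /= !dot_delta mxE eqxx /= [j == i]eq_sym.
have heat := profile_heat_supersolution q0 sz.
have K2 : 0 < K * (profile_t q z.2 - profile_rr q z.2) by rewrite mulr_gt0// subr_gt0.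
split=> [|g0].
  rewrite Egrad scaler_eq0 negb_or -sqnorm_eq0 -/q => /andP[_ qN0].
  suff -> : norm_inf_laplacian F z = K * profile_rr q z.2 by rewrite Edt -mulrBr.
  (* One row of the quadratic form: the rank-one part of the Hessian sums to |x|^2 = [q], the
     identity part keeps only j = i. *)
  have C1 i : \sum_(j < n) grad F z ord0 i * grad F z ord0 j * hess F z i j =
    - (K / 2) * Eq * c ^+ 2 * (4 * scale z.2 ^+ 2 * q + 2 * scale z.2) * z.1 ord0 i ^+ 2.
    rewrite (eq_bigr (fun j => - (K / 2) * Eq * c ^+ 2 * 4 * scale z.2 ^+ 2 *
      z.1 ord0 i ^+ 2 * z.1 ord0 j ^+ 2 + - (K / 2) * Eq * c ^+ 2 * 2 *
      scale z.2 * z.1 ord0 i * (z.1 ord0 j * (i == j)%:R))); last first.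
      by move=> j _; rewrite Ehess Egrad !mxE; ring.
    rewrite big_split/= -!mulr_sumr -/(sqnorm z.1) -/q.
    rewrite (bigD1 i)//= eqxx mulr1 big1 ?addr0; first by ring.
    by move=> j ji; rewrite eq_sym (negbTE ji) mulr0.
  rewrite /norm_inf_laplacian; under eq_bigr => i _ do rewrite C1.
  rewrite -mulr_sumr -/(sqnorm z.1) -/q Egrad sqnormZ -/q /profile_rr -/Eq.
  have cN0 : c != 0 by rewrite lt_eqF.

  by field; rewrite qN0 cN0.
have z0 : z.1 = 0.
  by move: g0; rewrite Egrad => /eqP; rewrite scaler_eq0 lt_eqF//= => /eqP.
have qz : q = 0 by rewrite /q z0; apply/eqP; rewrite sqnorm_eq0.
have -> : hess F z = (K * profile_rr q z.2)%:M.
  apply/matrixP => i j; rewrite Ehess !mxE z0 !mxE /profile_rr -/Eq qz.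
  by case: eqP => _ /=; field.
by rewrite max_eigenvalue_scalar// Edt -mulrBr.
Qed.

Definition lower_barrier (a K s : R) z :=
  a - K * profile (sqnorm z.1) z.2 + s * Num.sqrt (sqnorm z.1).

Definition lower_barrier_dir (a K s : R) e z :=
  a - K * profile (dot z.1 e ^+ 2) z.2 + s * dot z.1 e.

Lemma lower_barrier_dir_le (a K s : R) e z : slab z -> 0 <= K -> 0 <= s ->
  sqnorm e = 1 -> lower_barrier_dir a K s e z <= lower_barrier a K s z.
Proof.
move=> sz K0 s0 e1; have cs := cauchy_schwarz z.1 e1.
apply: lerD.
  by rewrite lerD2l lerN2 ler_wpM2l// profile_le.
rewrite ler_wpM2l// (le_trans (ler_norm _))// -sqrtr_sqr ler_wsqrtr//.
Qed.

(** Along a unit vector [e] the second derivative is the radial one taken at r = x . e, and the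
    linear term drops out. *)
Lemma jet2_lower_barrier_dir (a K s : R) e :
  exists2 W2, jet2 slab (lower_barrier_dir a K s e)
      (fun z v => - K * barrier1 (fun z => dot z.1 e ^+ 2)
         (fun z v => 2 * dot z.1 e * dot v.1 e) z v + s * dot v.1 e) W2 &
  sqnorm e = 1 -> forall z,
    W2 z (e, 0) (e, 0) = - K * profile_rr (dot z.1 e ^+ 2) z.2.
Proof.
have [W2 jW EW] := jet2_barrier (@jet2_sqdot R n e).
exists (fun z v w => - K * W2 z v w).
  have := jet2D (jet2D (@jet2_cst _ _ slab a) (jet2Z (- K) jW))
    (jet2Z s (@jet2_linear _ _ slab _ (linear_fst_dot e) (@continuous_fst_dot _ _ e))).
  move=> /(@jet2_eq _ _ slab); apply.
  - by move=> z; rewrite mulNr.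
  - by move=> z v; rewrite add0r.
  - by move=> z v w; rewrite add0r mulr0 addr0.
move=> e1 z; rewrite EW//= dot_sqnorm e1 /profile_rr; ring.
Qed.

Lemma continuous_upper_barrier (a K : R) z : slab z ->
  {for z, continuous (upper_barrier a K)}.
Proof. by have [W2 jW _] := jet2_upper_barrier a K; exact: jet2_continuous jW. Qed.

Lemma continuous_lower_barrier (a K s : R) z : slab z ->
  {for z, continuous (lower_barrier a K s)}.
Proof.
(* Continuity does not depend on the sign of the constant, so [upper_barrier] is reused with
   [- K]. *)
move=> sz; have -> : lower_barrier a K s =
    (fun z => upper_barrier a (- K) z + s * Num.sqrt (sqnorm z.1)).
  by apply/funext => y; rewrite /lower_barrier /upper_barrier mulNr.
apply: cvgD; first exact: continuous_upper_barrier.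
apply: cvgM; first exact: cvg_cst.
apply: continuous_comp; last exact: sqrt_continuous.
exact: jet2_continuous (@jet2_sqnorm R n) sz.
Qed.

(* Where x = 0 the two directions [d] and [- d] give contradictory values of the
   derivative of a test function along [d]; elsewhere the direction is x / |x|. *)
Lemma subsolution_lower_barrier (Omega : set ST) (a K s : R) : (0 < n)%N ->
  open Omega -> Omega `<=` slab -> 0 <= K -> 0 < s ->
  subsolution Omega (fun z => (lower_barrier a K s z)%:E).
Proof.
move=> n0 oO OS K0 s0; split => //.
  move=> z b Oz zb.
  have cw := @continuous_lower_barrier a K s _ (OS _ Oz).
  rewrite lte_fin in zb.
  have H := cvgr_lt _ cw _ zb.
  rewrite near_withinE; apply: filterS (H _) => y yb _.
  by rewrite lte_fin.
move=> psi z0 Cpsi [Oz zmax].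
(* A directional barrier lies below the radial one, so if they agree at [z0] it inherits the maximum
   there and, being smooth, can be compared with [psi]. *)
have touch e : sqnorm e = 1 -> lower_barrier_dir a K s e z0 = lower_barrier a K s z0 ->
   forall y, Omega y -> lower_barrier_dir a K s e y - psi y <=
     lower_barrier_dir a K s e z0 - psi z0.
  move=> e1 -> y Oy; have := zmax y Oy; rewrite -!EFinB lee_fin.
  by apply: le_trans; rewrite lerD2r lower_barrier_dir_le//; [exact: OS|exact: ltW].
have sz := OS _ Oz; have kp := scale_gt0 sz.
have [x0|x0] := eqVneq z0.1 0.
  pose d : 'rV[R]_n := delta_mx ord0 (Ordinal n0).
  have d1 : sqnorm d = 1 by rewrite -dot_sqnorm dot_delta mxE !eqxx.
  have dN1 : sqnorm (- d) = 1 by rewrite -scaleN1r sqnormZ d1; ring.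
  have E e : lower_barrier_dir a K s e z0 = lower_barrier a K s z0.
    by rewrite /lower_barrier_dir /lower_barrier x0 -!dot_sqnorm !dot0l sqrtr0 expr2 mulr0.
  have T e (e1 : sqnorm e = 1) : 'D_((d, 0) : ST) psi z0 = s * dot d e.
    have [W2 jW _] := jet2_lower_barrier_dir a K s e.
    have [-> _] := touching_jet2 (d, 0) oO Cpsi (jet2_subset OS jW) Oz (touch e e1 (E e)).
    by rewrite /barrier1 /= x0 !dot0l; ring.
  have := T d d1; rewrite (T (- d) dN1) -scaleN1r dotZr dot_sqnorm d1; lra.
pose r := Num.sqrt (sqnorm z0.1).
have r0 : 0 < r by rewrite sqrtr_gt0 lt_def sqnorm_ge0 sqnorm_eq0 x0.
have r2 : r ^+ 2 = sqnorm z0.1 by rewrite sqr_sqrtr// sqnorm_ge0.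
pose e := r^-1 *: z0.1.
have e1 : sqnorm e = 1 by rewrite sqnormZ -r2 exprVn mulVf// expf_neq0// gt_eqF.
have xe : dot z0.1 e = r by rewrite dotZr dot_sqnorm -r2 expr2 mulKf// gt_eqF.
have [W2 jW EW] := jet2_lower_barrier_dir a K s e.
have Ew : lower_barrier_dir a K s e z0 = lower_barrier a K s z0.
  by rewrite /lower_barrier_dir /lower_barrier xe -r2 -/r sqrtr_sqr ger0_norm// ltW.
have T v := touching_jet2 v oO Cpsi (jet2_subset OS jW) Oz (touch e e1 Ew).
have Edt : dt psi z0 = - K * profile_t (r ^+ 2) z0.2.
  rewrite /dt (T _).1 /barrier1 /dir_t /= dot0l xe /profile_t; ring.
(* The radial derivative of the barrier. It is positive, so the clause for a vanishing gradient is
   void. *)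
pose g := K * profile_exp (r ^+ 2) z0.2 * scale z0.2 * r + s.
have g0 : 0 < g.
  by rewrite ltr_wpDl// !mulr_ge0// ?expR_ge0// ltW.
have Egrad : grad psi z0 = g *: e.
  apply/rowP => i; rewrite mxE (T _).1 /barrier1 /dir_x /= xe dotC dot_delta.
  by rewrite [RHS]mxE /g; field.
have heat := profile_heat_supersolution (sqr_ge0 r) sz.
split=> [_|]; last first.
  rewrite Egrad => /eqP; rewrite -sqnorm_eq0 sqnormZ e1 mulr1 expf_eq0/=.
  by rewrite gt_eqF.
(* As the gradient of [psi] is [g *: e], its normalised Laplacian is the second derivative along
   [e], which touching bounds from below. *)
have : - K * profile_rr (r ^+ 2) z0.2 <= norm_inf_laplacian psi z0.
  have := (T ((e, 0) : ST)).2; rewrite EW// xe -(hess_quadratic _ oO Cpsi Oz).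
  suff -> : norm_inf_laplacian psi z0 =
    \sum_(i < n) \sum_(j < n) e ord0 i * e ord0 j * hess psi z0 i j by [].
  rewrite /norm_inf_laplacian Egrad sqnormZ e1 mulr1 mulr_sumr.
  apply: eq_bigr => i _; rewrite mulr_sumr; apply: eq_bigr => j _.
  rewrite [in LHS]mxE [X in _ * X * _](_ : _ = g * e ord0 j) ?[LHS]mxE//.
  by field; rewrite gt_eqF.
rewrite Edt; have : 0 <= K * (profile_t (r ^+ 2) z0.2 - profile_rr (r ^+ 2) z0.2).
  by rewrite mulr_ge0// subr_ge0 ltW.
lra.
Qed.

End sub_and_supersolutions.

(** * Comparison and geometry of the domain *)

Section semicontinuity.
Context {R : realType}.

Lemma lte_real_between (a b : \bar R) : (a < b)%E ->
  exists2 r : R, (a < r%:E)%E & (r%:E < b)%E.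
Proof.
case: a b => [a| |] [b| |] //.
- rewrite lte_fin => ab; exists ((a + b) / 2); rewrite lte_fin; lra.
- by move=> _; exists (a + 1); rewrite ?ltry// lte_fin; lra.
- by move=> _; exists (b - 1); rewrite ?ltNyr// lte_fin; lra.
- by move=> _; exists 0; rewrite ?ltNyr ?ltry.
Qed.

(** The sets where [h > a], for [a] below the supremum, generate a filter on [Omega], which clusters
    in the compact closure. If the supremum were not attained, [h] would stay below some such [a]
    near the cluster point. *)
Lemma usc_attains_max (T : topologicalType) (Omega : set T) (h : T -> \bar R) z1 :
  compact (closure Omega) -> Omega z1 -> (0 < h z1)%E ->
  (forall z (a : R), Omega z -> (h z < a%:E)%E ->
     \forall y \near within Omega (nbhs z), (h y < a%:E)%E) ->
  (forall z (a : R), closure Omega z -> ~ Omega z -> 0 < a ->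
     \forall y \near within Omega (nbhs z), (h y < a%:E)%E) ->
  exists2 z0, Omega z0 & forall z, Omega z -> (h z <= h z0)%E.
Proof.
move=> cO Oz1 h1 usc bdry; apply: contrapT => noz0.
pose M := ereal_sup (h @` Omega).
have hM z : Omega z -> (h z <= M)%E.
  by move=> Oz; apply: ereal_sup_ubound; exists z.
have ltM z : Omega z -> (h z < M)%E.
  move=> Oz; rewrite lt_neqAle hM// andbT; apply/eqP => E.
  by apply: noz0; exists z => // y /hM; rewrite E.
have M0 : (0 < M)%E := lt_le_trans h1 (hM _ Oz1).
pose B (a : R) := Omega `&` [set y | (a%:E < h y)%E].
pose FF := filter_from [set a : R | (a%:E < M)%E] B.
have fF : Filter FF.
  apply: filter_from_filter.
    by have [r _ rM] := lte_real_between M0; exists r.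
  move=> a b aM bM; exists (Num.max a b).
    by rewrite /= EFin_max gt_max; apply/andP.
  move=> y [Oy]; rewrite /= EFin_max gt_max => /andP[ay by_].
  by split; split.
have pF : ProperFilter FF.
  apply: filter_from_proper => a /= aM.
  by have [_ [y Oy <-] ay] := ereal_sup_gt aM; exists y.
have [] := cO FF pF.
  have [r _ rM] := lte_real_between M0.
  by exists r => // y [Oy _]; exact: subset_closure.
move=> z [cz clz].
(* Inside [Omega] take [a] between [h z] and the supremum; outside, between 0 and the supremum,
   which is positive because of [z1]. *)
have [a aM Ha] : exists2 a : R, (a%:E < M)%E &
    \forall y \near within Omega (nbhs z), (h y < a%:E)%E.
  have [Oz|nOz] := pselect (Omega z).
    have [a za aM] := lte_real_between (ltM z Oz).
    by exists a => //; exact: usc.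
  have [a a0 aM] := lte_real_between M0.
  by exists a => //; apply: bdry => //; rewrite -lte_fin.
have [|y [[Oy ay] Hy]] := clz (B a) _ _ Ha; first by exists a.
have := lt_trans ay (Hy Oy); by rewrite ltxx.
Qed.

Lemma limf_esup_lt (T : choiceType) (X : filteredType T) (u : X -> \bar R)
    (FF : set_system X) (a : \bar R) : Filter FF ->
  (limf_esup u FF < a)%E -> \forall y \near FF, (u y < a)%E.
Proof.
move=> fF /ereal_inf_lt[_ [A FA <-]] uA.
apply: filterS FA => y Ay; apply: le_lt_trans uA.
by apply: ereal_sup_ubound; exists y.
Qed.

Lemma limf_esup_le (T : choiceType) (X : filteredType T) (u : X -> \bar R)
    (FF : set_system X) (l : R) :
  (forall e : R, 0 < e -> \forall y \near FF, (u y <= (l + e)%:E)%E) ->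
  (limf_esup u FF <= l%:E)%E.
Proof.
move=> H; apply/lee_addgt0Pr => e e0; rewrite -EFinD.
apply: ge_ereal_inf; exists (ereal_sup (u @` [set y | (u y <= (l + e)%:E)%E])).
  by exists [set y | (u y <= (l + e)%:E)%E] => //; exact: H.
by apply: ge_ereal_sup => _ [y /= uy <-].
Qed.

Lemma closure_le (T : topologicalType) (Omega : set T) (f g : T -> R) z :
  {for z, continuous f} -> {for z, continuous g} ->
  (forall y, Omega y -> f y <= g y) -> closure Omega z -> f z <= g z.
Proof.
move=> cf cg fg cz; rewrite -subr_le0 leNgt; apply/negP => fz.
have c : {for z, continuous (fun y => f y - g y)} by apply: cvgB; [exact: cf|exact: cg].
have H := cvgr_gt _ c _ fz.
have [y [Oy]] := cz _ (H _).
by rewrite /= subr_gt0 ltNge fg.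
Qed.

End semicontinuity.

(** * Growth of the iterated logarithm *)

Section loglog_bounds.
Context {R : realType}.
Implicit Types t : R.

(** The bound ln y < y is used twice: ln s < s, and s = 2 ln (1 / sqrt (-t)) < 2 / sqrt (-t). *)
Lemma loglog_le t : -1 < t < 0 -> loglog t <= 2 / Num.sqrt (- t).
Proof.
move=> tI; have l0 := ln_opp_lt0 tI; have /andP[_ t0] := tI.
have m0 : 0 < Num.sqrt (- t) by rewrite sqrtr_gt0; lra.
set m := Num.sqrt _ in m0 *.
have E : - t = m ^+ 2 by rewrite sqr_sqrtr//; lra.
have : loglog t < - ln (- t) by apply: ln_sublinear; lra.
have : ln (m^-1) < m^-1 by apply: ln_sublinear; rewrite invr_gt0.
rewrite lnV ?posrE// E lnXn// mulr2n.
lra.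
Qed.

Lemma loglog_gt0 t : - expR (-1) < t -> t < 0 -> 0 < loglog t.
Proof.
move=> te t0; apply: ln_gt0; rewrite ltrNr -ltr_expR lnK ?posrE; lra.
Qed.

Lemma loglog_gt0_inv t : -1 < t < 0 -> 0 < loglog t -> - expR (-1) < t.
Proof.
move=> tI; have l0 := ln_opp_lt0 tI; have /andP[_ t0] := tI => l1.
have : 1 < - ln (- t).
  by rewrite ltNge; apply/negP => /ln_le0; rewrite -/(loglog t); lra.
rewrite ltrNr -ltr_expR lnK ?posrE; lra.
Qed.

Lemma loglog_decay (e : R) : 0 < e -> exists2 d : R, 0 < d &
  forall t, - d < t -> t < 0 -> expR (- (1 / 4) * loglog t) < e.
Proof.
(* [S] is the given bound to the power -4, so s > [S] amounts to s^(-1/4) below the bound; and s >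
   [S] means - t < [expR (- S)]. *)
move=> e0; pose S := expR (- 4 * ln e).
have S0 : 0 < S := expR_gt0 _.
exists (expR (- S)); first exact: expR_gt0.
move=> t td t0.
have : S < - ln (- t) by rewrite ltrNr -ltr_expR lnK ?posrE; lra.
move=> H; have H1 : ln S < loglog t.
  by rewrite /loglog ltr_ln// posrE (lt_trans S0).
rewrite -[ltRHS]lnK ?posrE// ltr_expR.
by move: H1; rewrite /S expRK; lra.
Qed.

Lemma loglog_mono (d t : R) : -1 < t < 0 -> t <= - d -> 0 < d ->
  loglog t <= loglog (- d).
Proof.
move=> tI td d0; have l0 := ln_opp_lt0 tI; have /andP[_ t0] := tI.
have H : ln d <= ln (- t) by rewrite ler_ln ?posrE; lra.
rewrite /loglog opprK ler_ln ?posrE; lra.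
Qed.

End loglog_bounds.

(** * Geometry of the domain and its closure *)

Section domain.
Context {R : realType} {n : nat}.
Variable c : R.
Hypotheses (c0 : 0 < c) (c1 : c < 1).
Notation ST := (spacetime R n).
Notation slab := (@slab R n).
Notation Omega := (@petrovsky_domain R n c).
Implicit Types (z y : ST).

(** With [c < 1] the domain lies in the slab, where the signs under both absolute values are
    known. *)
Lemma petrovskyP z : Omega z <->
  [/\ slab z, - c < z.2 & sqnorm z.1 < - 4 * z.2 * loglog z.2].
Proof.
have E : slab z -> ln `|ln `|z.2| | = loglog z.2.
  move=> sz; have l0 := ln_opp_lt0 sz; have /andP[_ t0] := sz.
  by rewrite (ltr0_norm t0) (ltr0_norm l0).
split=> [[h1 h2 h3]|[sz h1 h2]].
  have sz : slab z by rewrite /slab /= h2 andbT (lt_trans _ h1)// ltrN2.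
  by split => //; rewrite -E.
by split=> //; [case/andP: sz|rewrite E].
Qed.

Lemma petrovsky_slab : Omega `<=` slab.
Proof. by move=> z /petrovskyP[]. Qed.

Lemma continuous_loglog z : slab z -> {for z, continuous (fun z => loglog z.2)}.
Proof. exact: jet2_continuous (jet2_time_comp (@loglog_derive R)). Qed.

Lemma continuous_scale z : slab z -> {for z, continuous (fun z => scale z.2)}.
Proof. exact: jet2_continuous (jet2_time_comp (@scale_derive R)). Qed.

Lemma continuous_time : continuous (fun z => z.2).
Proof. by move=> z; exact: cvg_snd. Qed.

Lemma continuous_sqnorm : continuous (fun z => sqnorm z.1).
Proof.
have -> : (fun z => sqnorm z.1) =
    (fun z => \sum_(i < n) dot z.1 (delta_mx ord0 i) * dot z.1 (delta_mx ord0 i)).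
  by apply/funext => z; apply: eq_bigr => i _; rewrite dot_delta expr2.
move=> z; apply: cvg_big => [|i _]; first exact: add_continuous.
by apply: cvgM; exact: continuous_fst_dot.
Qed.

Lemma open_petrovsky : open Omega.
Proof.
rewrite openE => z /petrovskyP[sz zc zq].
have n1 : \forall y \near z, slab y.
  by apply: open_nbhs_nbhs; split => //; exact: open_slab.
have n2 := cvgr_gt _ (@continuous_time z) _ zc.
have c3 : {for z, continuous (fun z => - 4 * z.2 * loglog z.2 - sqnorm z.1)}.
  apply: cvgB; last exact: continuous_sqnorm.
  apply: cvgM; last exact: continuous_loglog.
  by apply: cvgM; [exact: cvg_cst|exact: continuous_time].
have zq' : 0 < - 4 * z.2 * loglog z.2 - sqnorm z.1 by rewrite subr_gt0.
have n3 := cvgr_gt _ c3 _ zq'.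
apply: filterS (filterI n1 (filterI (n2 _) (n3 _))) => y [y1 [y2 y3]].
by apply/petrovskyP; split => //; rewrite -subr_gt0.
Qed.

Lemma petrovsky_scale z : Omega z -> sqnorm z.1 * scale z.2 < loglog z.2.
Proof.
move=> /petrovskyP[/andP[_ t0] _ h].
by rewrite /scale ltr_pdivrMr; [rewrite mulrC; lra|lra].
Qed.

(** A nonnegative |x|^2 forces [loglog] to be positive. So, whatever [c] is, the closure keeps away
    from t = -1, where [loglog] is singular. *)
Lemma petrovsky_time z : Omega z -> - expR (-1) < z.2.
Proof.
move=> Oz; have sz := petrovsky_slab Oz.
apply: loglog_gt0_inv => //; apply: le_lt_trans (petrovsky_scale Oz).
by rewrite mulr_ge0 ?sqnorm_ge0// ltW// scale_gt0.
Qed.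

(** From [loglog_le]: -4 t * 2 / sqrt (-t) = 8 sqrt (-t). Unlike the defining bound, this one is
    visibly continuous up to t = 0 and so passes to the closure. *)
Lemma petrovsky_sqnorm z : Omega z -> sqnorm z.1 <= 8 * Num.sqrt (- z.2).
Proof.
move=> /petrovskyP[sz _ /ltW h]; apply: le_trans h _.
have /andP[_ t0] := sz.
have m0 : 0 < Num.sqrt (- z.2) by rewrite sqrtr_gt0; lra.
have := loglog_le sz.
set m := Num.sqrt _ in m0 *.
have -> : z.2 = - m ^+ 2 by rewrite sqr_sqrtr ?opprK//; lra.
move=> H; have -> : 8 * m = - 4 * - m ^+ 2 * (2 / m) by field; rewrite gt_eqF.
by rewrite ler_wpM2l// mulrNN mulr_ge0// sqr_ge0.
Qed.

Lemma closure_time_le0 z : closure Omega z -> z.2 <= 0.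
Proof.
move=> cz; apply: (closure_le (@continuous_time z) (cvg_cst 0)) cz.
by move=> y /petrovskyP[/andP[_ /ltW]].
Qed.

Lemma closure_time_ge z : closure Omega z -> - expR (-1) <= z.2.
Proof.
move=> cz; apply: (closure_le (cvg_cst (- expR (-1))) (@continuous_time z)) cz.
by move=> y /petrovsky_time/ltW.
Qed.

Lemma expRN1_lt1 : expR (-1) < 1 :> R.
Proof. by rewrite expR_lt1; lra. Qed.

Lemma closure_slab z : closure Omega z -> z.2 < 0 -> slab z.
Proof.
move=> /closure_time_ge; rewrite /slab /= => H ->; rewrite andbT.
have := expRN1_lt1; lra.
Qed.

Lemma closure_sqnorm z : closure Omega z -> sqnorm z.1 <= 8 * Num.sqrt (- z.2).
Proof.
move=> cz; apply: (closure_le (@continuous_sqnorm z) _ petrovsky_sqnorm cz).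
apply: cvgM; first exact: cvg_cst.
apply: continuous_comp; last exact: sqrt_continuous.
by apply: cvgN; exact: continuous_time.
Qed.

Lemma closure_sqnorm_le z : closure Omega z -> sqnorm z.1 <= 8.
Proof.
move=> cz; apply: le_trans (closure_sqnorm cz) _.
have h0 := closure_time_le0 cz; have h1 := closure_time_ge cz.
have : Num.sqrt (- z.2) <= Num.sqrt 1.
  by rewrite ler_wsqrtr//; have := expRN1_lt1; lra.
by rewrite sqrtr1; lra.
Qed.

Lemma closure_scale z : closure Omega z -> z.2 < 0 ->
  sqnorm z.1 * scale z.2 <= loglog z.2.
Proof.
move=> cz t0; have sz := closure_slab cz t0.
apply: (@closure_le _ _ Omega (fun z => sqnorm z.1 * scale z.2)
  (fun z => loglog z.2)) => //.
- by apply: cvgM; [exact: continuous_sqnorm|exact: continuous_scale].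
- exact: continuous_loglog.
- by move=> y /petrovsky_scale/ltW.
Qed.

(** At t = 0 the bound 8 sqrt (-t) leaves only x = 0. Hence every other boundary point lies in the
    slab, where the barriers are continuous. *)
Lemma closure_time0 z : closure Omega z -> ~~ (z.2 < 0) -> z = (0, 0).
Proof.
move=> cz; rewrite -leNgt => t0.
have {}t0 : z.2 = 0 by apply/eqP; rewrite eq_le t0 closure_time_le0.
have := closure_sqnorm cz; rewrite t0 oppr0 sqrtr0 mulr0 => q0.
rewrite [z]surjective_pairing t0; congr pair; apply/eqP.
by rewrite -sqnorm_eq0 eq_le q0 sqnorm_ge0.
Qed.

Lemma coord_sqnorm (x : 'rV[R]_n) i : x ord0 i ^+ 2 <= sqnorm x.
Proof.
by rewrite /sqnorm (bigD1 i)//= lerDl; apply: sumr_ge0 => j _; exact: sqr_ge0.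
Qed.

Lemma compact_closure_petrovsky : compact (closure Omega).
Proof.
(* Coordinates satisfy x_i^2 <= |x|^2 <= 8 < 3^2. *)
pose K : set ST := [set x : 'rV[R]_n | forall i,
    (`[- 3, 3]%classic : set R) (x ord0 i)] `*` (`[-1, 0]%classic : set R).
have cK : compact K.
  apply: compact_setX; last exact: segment_compact.
  apply: (@rV_compact R n (fun=> `[- 3, 3]%classic)) => _.
  exact: segment_compact.
apply: subclosed_compact cK _; first exact: closed_closure.
move=> z cz; split.
  move=> i; have := coord_sqnorm z.1 i; have := closure_sqnorm_le cz.
  by rewrite /= in_itv /= => h1 h2; apply/andP; split; nra.
rewrite /= in_itv /= closure_time_le0// andbT.
by have := closure_time_ge cz; have := expRN1_lt1; lra.
Qed.

Lemma boundary_closure z : boundary Omega z -> closure Omega z.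
Proof. by case. Qed.

Lemma boundary_origin : boundary Omega (0, 0).
Proof.
split; last first.
  by move=> /interior_subset/petrovskyP[/andP[_]]; rewrite ltxx.
move=> B B0.
(* The origin is approached along the time axis, which lies in the domain once t exceeds [- c] and
   [- expR (-1)]. *)
have cv : (fun t : R => ((0, t) : ST)) @ 0^'- --> ((0, 0) : ST).
  have h1 : (fun=> 0 : 'rV[R]_n) @ (0 : R)^'- --> (0 : 'rV[R]_n) by exact: cvg_cst.
  have h2 : (fun t : R => t) @ (0 : R)^'- --> (0 : R).
    by apply: cvg_at_left_filter; exact: cvg_id.
  exact: cvg_pair h1 h2.
have n1 : \forall t \near (0 : R)^'-, B (0, t) := cv _ B0.
have n2 : \forall t \near (0 : R)^'-, t < 0 by exact: nbhs_left_lt.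
have n3 : \forall t \near (0 : R)^'-, - c < t by apply: nbhs_left_gt; rewrite oppr_lt0.
have n4 : \forall t \near (0 : R)^'-, - expR (-1) < t.
  by apply: nbhs_left_gt; rewrite oppr_lt0 expR_gt0.
have [t [Bt [t0 [tc te]]]] := filter_ex (filterI n1 (filterI n2 (filterI n3 n4))).
exists (0, t); split => //; apply/petrovskyP; split => //=.
  by rewrite /slab /= t0 andbT (lt_trans _ tc)// ltrN2.
rewrite -dot_sqnorm dot0l mulr_gt0//; first lra.
exact: loglog_gt0.
Qed.

Lemma profile_ge0_petrovsky z : Omega z -> 0 <= profile (sqnorm z.1) z.2.
Proof.
move=> Oz; apply: le_trans (profile_ge (petrovsky_slab Oz) (ltW (petrovsky_scale Oz))).
by rewrite mulr_ge0// expR_ge0.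
Qed.

(** As s increases with t, the lower bound s^(-1/4) / 2 is smallest at t = - d. *)
Lemma profile_ge_closure (d : R) : 0 < d -> exists2 m : R, 0 < m &
  forall z, closure Omega z -> z.2 <= - d -> m <= profile (sqnorm z.1) z.2.
Proof.
move=> d0; exists (1 / 2 * expR (- (1 / 4) * loglog (- d))).
  by rewrite mulr_gt0// expR_gt0.
move=> z cz zd; have t0 : z.2 < 0 by lra.
have sz := closure_slab cz t0.
apply: le_trans (profile_ge sz (closure_scale cz t0)).
rewrite ler_wpM2l// ler_expR ler_wnM2l//.
exact: loglog_mono.
Qed.

End domain.

(** * Regularity of the origin *)

Section regularity.
Context {R : realType} {n : nat} (c : R).
Hypotheses (n0 : (0 < n)%N) (c0 : 0 < c) (c1 : c < 1).
Notation ST := (spacetime R n).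
Notation slab := (@slab R n).
Notation Omega := (@petrovsky_domain R n c).
Implicit Types (z y : ST) (f : ST -> R).

Lemma profile_ge0_closure z : closure Omega z -> z.2 < 0 ->
  0 <= profile (sqnorm z.1) z.2.
Proof.
move=> cz t0.
apply: le_trans (profile_ge (closure_slab c1 cz t0) (closure_scale c1 cz t0)).
by rewrite mulr_ge0// expR_ge0.
Qed.

(** On the closure |x|^2 <= 8 sqrt (-t), so smallness of time alone gives closeness to the
    origin. *)
Lemma closure_near_origin (P : set ST) : nbhs ((0, 0) : ST) P ->
  exists2 d : R, 0 < d & forall z, closure Omega z -> - d < z.2 -> P z.
Proof.
move=> /nbhs_ballP[e /= e0 eP].
(* The second entry solves 8 sqrt d = e^2; the first controls the time coordinate. *)
have d0 : 0 < Num.min e ((e ^+ 2 / 8) ^+ 2).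
  by rewrite lt_min e0 exprn_gt0// divr_gt0// exprn_gt0.
exists (Num.min e ((e ^+ 2 / 8) ^+ 2)) => // z cz zd; apply: eP.
have t0 := closure_time_le0 c1 cz.
have : - z.2 < Num.min e ((e ^+ 2 / 8) ^+ 2) by lra.
rewrite lt_min => /andP[te tq]; split; last first.
  by rewrite /ball /= sub0r normrN ler0_norm.
split=> [|i j]; first by [].
rewrite mxE /ball /= sub0r normrN (ord1 i).
rewrite -(@ltr_pXn2r _ 2)// ?nnegrE ?normr_ge0 ?(ltW e0)//.
rewrite real_normK ?num_real//.
apply: le_lt_trans (coord_sqnorm _ _) _.
apply: le_lt_trans (closure_sqnorm c1 cz) _.
rewrite mulrC -ltr_pdivlMr// -[ltRHS]ger0_norm ?divr_ge0 ?exprn_ge0 ?(ltW e0)//.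
by rewrite -sqrtr_sqr ltr_sqrt// exprn_gt0// divr_gt0// exprn_gt0.
Qed.

Lemma compact_boundary : compact (boundary Omega).
Proof.
apply: subclosed_compact (compact_closure_petrovsky c1) _ => [|z []//].
apply: closedI; first exact: closed_closure.
by apply: open_closedC; exact: open_interior.
Qed.

(** Near the origin continuity of [f] gives [e]; elsewhere the profile has a positive lower bound,
    and a large [K] absorbs the oscillation of the bounded [f]. *)
Lemma boundary_oscillation f (e : R) : {within boundary Omega, continuous f} ->
  0 < e -> exists2 K : R, 0 < K & forall z, boundary Omega z -> z.2 < 0 ->
  `|f z - f (0, 0)| <= e + K * profile (sqnorm z.1) z.2.
Proof.
move=> cf e0.
have O0 := boundary_origin c0 c1 : boundary Omega ((0, 0) : ST).
have /closure_near_origin[d d0 Hd] : nbhs ((0, 0) : ST)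
    [set y | boundary Omega y -> `|f (0, 0) - f y| < e].
  have /subspace_continuousP/(_ _ O0)/cvgrPdist_lt/(_ e e0) := cf.
  exact.
have [M [Mr HM]] := compact_bounded (continuous_compact cf compact_boundary).
have fM z : boundary Omega z -> `|f z| <= M + 1.
  by move=> bz; apply: (HM (M + 1)); [rewrite ltrDl|exists z].
have M0 : 0 <= M + 1 := le_trans (normr_ge0 _) (fM _ O0).
have [m m0 Hm] := @profile_ge_closure R n c c1 d d0.
(* Then [K * m] exceeds twice the bound [M + 1] on |f|; the last 1 keeps [K] positive. *)
exists ((2 * (M + 1) + 1) / m); first by rewrite divr_gt0//; lra.
move=> z bz t0; have cz := boundary_closure bz.
have [zd|zd] := ltP (- d) z.2.
  rewrite distrC (le_trans (ltW (Hd z cz zd bz)))// lerDl.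
  by rewrite mulr_ge0 ?profile_ge0_closure// divr_ge0 ?(ltW m0)//; lra.
have H1 := Hm z cz zd.
have H2 : 2 * (M + 1) + 1 <= (2 * (M + 1) + 1) / m * profile (sqnorm z.1) z.2.
  by rewrite mulrAC ler_pdivlMr// ler_wpM2l//; lra.
have := ler_normB (f z) (f (0, 0)); have := fM _ bz; have := fM _ O0; lra.
Qed.

(** Otherwise [v - F] would be positive somewhere and attain a maximum inside the domain, its upper
    limits at the boundary being at most 0. There [F] is an admissible test function, against its
    strict supersolution inequality. *)
Lemma lower_class_le_upper_barrier f (a K : R) v : 0 < K ->
  lower_class Omega f v ->
  (forall z, boundary Omega z -> z.2 < 0 -> f z <= upper_barrier a K z) ->
  f (0, 0) <= a ->
  forall z, Omega z -> (v z <= (upper_barrier a K z)%:E)%E.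
Proof.
move=> K0 [[vfin vusc vsub] vbd] fF f0 z1 Oz1; set F := upper_barrier a K.
have OS := @petrovsky_slab R n c c1.
rewrite leNgt; apply/negP => vz1.
pose h z := (v z - (F z)%:E)%E.
have h1 : (0 < h z1)%E by rewrite /h sube_gt0.
have [z0 Oz0 zmax] : exists2 z0, Omega z0 & forall z, Omega z -> (h z <= h z0)%E.
  apply: (usc_attains_max (compact_closure_petrovsky c1) Oz1 h1).
    move=> z b Oz; rewrite /h lteBlDr// => /lte_real_between[r vr rb].
    have H1 := vusc z r Oz vr; rewrite near_withinE in H1.
    have rb' : r - b < F z by rewrite -EFinD lte_fin in rb; lra.
    have H2 := cvgr_gt _ (@continuous_upper_barrier R n a K z (OS _ Oz)) _ rb'.
    rewrite near_withinE; apply: filterS (filterI H1 (H2 _)) => y [y1 y2] Oy.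
    rewrite lteBlDr//; apply: lt_trans (y1 Oy) _.
    by rewrite -EFinD lte_fin; rewrite -/F /= in y2; lra.
  move=> z b cz nOz b0.
  have bz : boundary Omega z by split => // /interior_subset.
  have : (limf_esup v (within Omega (nbhs z)) < (f z + b / 2)%:E)%E.
    by apply: le_lt_trans (vbd z bz) _; rewrite lte_fin; lra.
  move=> /limf_esup_lt H1; rewrite near_withinE in H1.
  have H2 : \forall y \near z, Omega y -> f z - b / 2 < F y.
    have [t0|t0] := boolP (z.2 < 0).
      have zb : f z - b / 2 < F z by have := fF z bz t0; rewrite -/F; lra.
      have H2 := cvgr_gt _ (@continuous_upper_barrier R n a K z
        (closure_slab c1 cz t0)) _ zb.
      by apply: filterS (H2 _) => y.
    (* At the origin the formula for [F] carries no information; points of the domain satisfy F >= a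
       >= f (0, 0) since the profile is nonnegative there. *)
    apply: filterS (filterT : nbhs z setT) => y _ Oy; rewrite (closure_time0 c1 cz t0).
    have := mulr_ge0 (ltW K0) (profile_ge0_petrovsky c1 Oy).
    rewrite /F /upper_barrier; lra.
  rewrite near_withinE; apply: filterS (filterI H1 H2) => y [y1 y2] Oy.
  rewrite /h lteBlDr//; apply: lt_trans (y1 Oy) _.
  by rewrite -EFinD lte_fin; have := y2 Oy; lra.
have C2F : C2_on Omega F := C2_on_subset OS (@C2_on_upper_barrier R n a K).
have [s1 s2] := vsub F z0 C2F (conj Oz0 zmax).
have [t1 t2] := @upper_barrier_strict R n a K z0 n0 K0 (OS _ Oz0).
have [g0|g0] := eqVneq (grad F z0) 0.
  by have := s2 g0; rewrite leNgt t2.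
by have := s1 g0; rewrite leNgt t1.
Qed.

(** The slope [e / 3] costs at most [e], because |x| < 3 on the closure; this is paid by subtracting
    [2 * e] rather than [e]. *)
Lemma lower_barrier_in_lower_class f (e K : R) : 0 < e -> 0 < K ->
  (forall z, boundary Omega z -> z.2 < 0 ->
     f (0, 0) - e - K * profile (sqnorm z.1) z.2 <= f z) ->
  lower_class Omega f
    (fun z => (lower_barrier (f (0, 0) - 2 * e) K (e / 3) z)%:E).
Proof.
move=> e0 K0 Hf; set w := lower_barrier _ _ _.
have OS := @petrovsky_slab R n c c1.
have wle z : closure Omega z ->
    w z <= f (0, 0) - e - K * profile (sqnorm z.1) z.2.
  move=> cz; rewrite /w /lower_barrier.
  have : Num.sqrt (sqnorm z.1) <= Num.sqrt (3 ^+ 2).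
    by rewrite ler_wsqrtr//; have := closure_sqnorm_le c1 cz; lra.
  rewrite sqrtr_sqr ger0_norm// => H.
  have : e / 3 * Num.sqrt (sqnorm z.1) <= e / 3 * 3.
    by rewrite ler_wpM2l// divr_ge0// ltW.
  lra.
split.
  apply: subsolution_lower_barrier => //; [exact: open_petrovsky|exact: ltW|].
  by rewrite divr_gt0.
move=> z bz; have cz := boundary_closure bz.
apply: limf_esup_le => d d0; rewrite near_withinE.
have [t0|t0] := boolP (z.2 < 0).
  have wz : w z < f z + d by have := wle z cz; have := Hf z bz t0; lra.
  have H := cvgr_lt _ (@continuous_lower_barrier R n (f (0, 0) - 2 * e) K (e / 3) z
    (closure_slab c1 cz t0)) _ wz.
  by apply: filterS (H _) => y yd _; rewrite lee_fin ltW.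
apply: filterS (filterT : nbhs z setT) => y _ Oy; rewrite (closure_time0 c1 cz t0) lee_fin.
have := mulr_ge0 (ltW K0) (profile_ge0_petrovsky c1 Oy).
have := wle y (subset_closure Oy); lra.
Qed.

(** Near the origin [K] times the profile is at most [e], so the constants of the barriers, - 2 e
    and + e, worsen to - 3 e and + 2 e. *)
Lemma lower_perron_near_origin f (e : R) :
  {within boundary Omega, continuous f} -> 0 < e ->
  \forall z \near within Omega (nbhs ((0, 0) : ST)),
    ((f (0, 0) - 3 * e)%:E <= lower_perron Omega f z)%E /\
    (lower_perron Omega f z <= (f (0, 0) + 2 * e)%:E)%E.
Proof.
move=> cf e0; have [K K0 HK] := boundary_oscillation cf e0.
have eK : 0 < e / K by rewrite divr_gt0.
have [d d0 Hd] := loglog_decay eK.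
have nd : \forall z \near ((0, 0) : ST), - d < z.2.
  have H := cvgr_gt _ (@continuous_time R n (0, 0)) (- d) _.
  by apply: H; rewrite oppr_lt0.
rewrite near_withinE; apply: filterS nd => z zd Oz.
have /andP[_ t0] := petrovsky_slab c1 Oz.
have small : K * profile (sqnorm z.1) z.2 <= e.
  rewrite mulrC -ler_pdivlMr//.
  exact: le_trans (profile_le_decay _ _) (ltW (Hd _ zd t0)).
split.
  have wL : lower_class Omega f
      (fun z => (lower_barrier (f (0, 0) - 2 * e) K (e / 3) z)%:E).
    apply: lower_barrier_in_lower_class => // y yb yt.
    by have := HK y yb yt; rewrite ler_norml => /andP[+ _]; lra.
  apply: le_trans (ereal_sup_ubound (imageP (fun v => v z) wL)).
  rewrite lee_fin /lower_barrier.
  have : 0 <= e / 3 * Num.sqrt (sqnorm z.1) by rewrite mulr_ge0// divr_ge0// ltW.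
  lra.
apply: ge_ereal_sup => _ [v vL <-].
have := @lower_class_le_upper_barrier f (f (0, 0) + e) K v K0 vL _ _ z Oz.
move=> H; apply: le_trans (H _ _) _.
- move=> y yb yt; have := HK y yb yt; rewrite ler_norml /upper_barrier => /andP[_].
  lra.
- lra.
- rewrite lee_fin /upper_barrier; lra.
Qed.

End regularity.

Theorem theorem1p3 (R : realType) (n : nat) (c : R) :
  (0 < n)%N -> 0 < c -> c < 1 ->
  regular_point (petrovsky_domain n c) (0, 0).
Proof.
move=> n0 c0 c1; split; first exact: boundary_origin.
move=> f cf U /= [e /= e0 eU].
(* The errors 3 e / 4 and 2 e / 4 are both below [e]. *)
have e4 : 0 < e / 4 by rewrite divr_gt0.
apply: filterS (lower_perron_near_origin n0 c0 c1 cf e4) => z.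
rewrite /preimage /=; case: (lower_perron _ _ z) => [r| |] [] //; rewrite !lee_fin => h1 h2.
apply: (eU r); rewrite /ball /= ltr_norml; apply/andP; split; lra.
Qed.
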